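(* Let $\mathcal{G}$ be a compact group acting continuously on a sample space $\mathcal{Y}$, equipped with a filtration $(\mathcal{I}_n)_{n\geq 0}$, and let $(\varepsilon_n)_{n \geq 0}$, $\varepsilon_n : \mathcal{Y} \to [0,\infty]$, be a stochastic process adapted to $(\mathcal{I}_n)_{n\geq 0}$. Then $(\varepsilon_n)_{n \geq 0}$ is anytime valid for $\mathcal{G}$ invariance if and only if for every orbit $O \in \mathcal{Y}/\mathcal{G}$ there exists a non-negative $\mathrm{Unif}(O)$-martingale $(\varepsilon_n^O)_{n\geq 0}$ (with respect to $(\mathcal{I}_n)_{n\geq 0}$) that starts at $1$ and bounds $(\varepsilon_n)_{n\geq 0}$ from above, $\mathrm{Unif}(O)$-a.s. (i.e. $\varepsilon_n \leq \varepsilon_n^O$ for all $n$, $\mathrm{Unif}(O)$-a.s.).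
   Context: All spaces are second-countable locally compact Hausdorff, equipped with their Borel $\sigma$-algebras; $\mathcal{I}$ is the $\sigma$-algebra on $\mathcal{Y}$ and $\mathcal{I}_n \subseteq \mathcal{I}$ with $\mathcal{I}_0 = \{\emptyset,\mathcal{Y}\}$. Stopping times are with respect to $(\mathcal{I}_n)_{n \geq 0}$ and take values in $\{0,1,2,\dots\}$. The orbit of $y$ is $O_y = \{Gy : G \in \mathcal{G}\}$; $\mathrm{Unif}(O)$ is the law of $\overline{G}y$ for any $y \in O$, with $\overline{G}$ following the Haar probability measure on $\mathcal{G}$. A probability $\mathbb{P}$ on $\mathcal{Y}$ is $\mathcal{G}$ invariant if $\mathbb{P}(G^{-1}A) = \mathbb{P}(A)$ for all $G \in \mathcal{G}$ and events $A$. The process $(\varepsilon_n)_{n\geq0}$ is anytime valid for $\mathcal{G}$ invariance if for every stopping time $\tau$, $\mathbb{E}^{\mathbb{P}}[\varepsilon_\tau] \leq 1$ for every $\mathcal{G}$ invariant probability $\mathbb{P}$. *)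

(* Defs.v *)
From HB Require Import structures.
From mathcomp Require Import all_boot all_order all_algebra.
From mathcomp Require Import all_classical all_reals all_analysis.
From mathcomp Require Import measurable_realfun.

Set Implicit Arguments.
Unset Strict Implicit.
Unset Printing Implicit Defensive.

Import Order.TTheory GRing.Theory Num.Theory.
Import numFieldTopology.Exports.
Local Open Scope classical_set_scope.
Local Open Scope ring_scope.

(* The multiplicative groups of [monoid.v] carry no topology. The base point
   is only there because measurable types are pointed. *)
HB.mixin Record isTopologicalGroup G of Group G & PointedTopological G := {
  mulg_continuous : continuous (fun p : G * G => (p.1 * p.2)%g) ;
  invg_continuous : continuous (fun g : G => (g^-1)%g)
}.

#[short(type="topologicalGroupType")]
HB.structure Definition TopologicalGroup :=
  {G of isTopologicalGroup G & Group G & PointedTopological G}.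

Notation borel T := (g_sigma_algebraType (@open T)).

Record continuous_action (G : topologicalGroupType) (Y : ptopologicalType) :=
  ContinuousAction {
    act :> G -> Y -> Y ;
    act1 : forall y, act 1%g y = y ;
    actM : forall g h y, act (g * h)%g y = act g (act h y) ;
    act_continuous : continuous (fun p : G * Y => act p.1 p.2)
  }.

Lemma continuous_comp_pair (S T U V : topologicalType) (f : T * U -> V)
    (g : S -> T) (h : S -> U) : continuous f -> continuous g ->
  continuous h -> continuous (fun x => f (g x, h x)).
Proof.
move=> cf cg ch x.
apply: (@cvg_comp _ _ _ (fun x => (g x, h x)) f _ (nbhs (g x, h x))); last first.
  exact: cf.
apply: cvg_pair; [exact: cg|exact: ch].
Qed.

Section borel_measurability.
Context (S T : ptopologicalType).

Lemma continuous_borel_measurable (f : S -> T) :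
  continuous f -> measurable_fun setT (f : borel S -> borel T).
Proof.
move=> /continuousP cf.
apply: (@measurability _ _ (borel S) (borel T) _ _ (@open T)) => //.
by move=> _ [U oU <-]; rewrite setTI; apply: sub_gen_smallest; exact: cf.
Qed.

(* Second countability is what makes a function continuous on a product
   measurable for the product of the Borel sigma-algebras. *)
Lemma continuous_prod_borel_measurable (U : ptopologicalType)
    (f : S * T -> U) : @second_countable S -> @second_countable T ->
  continuous f -> measurable_fun setT (f : borel S * borel T -> borel U).
Proof.
move=> [B cB [oB bB]] [C cC [oC bC]] /continuousP cf.
apply: (@measurability _ _ (borel S * borel T)%type (borel U) _ _
  (@open U)) => //.
move=> _ [V oV <-]; rewrite setTI.
have {oV cf} := cf _ oV; set W := f @^-1` V => oW.
pose D := [set p : set S * set T | (B `*` C) p /\ p.1 `*` p.2 `<=` W].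
have -> : W = \bigcup_(p in D) (p.1 `*` p.2).
  apply/seteqP; split=> [[s t] Wst|st [p [_ pW] /pW]//].
  have [[N M] /= [sN tM] NMW] : nbhs (s, t) W by exact: open_nbhs_nbhs.
  have [N' [BN' N's] N'N] := bB s _ sN.
  have [M' [CM' M't] M'M] := bC t _ tM.
  exists (N', M') => //; split => // -[x y] /= [N'x M'y].
  by apply: NMW; split; [exact: N'N|exact: M'M].
have cD : countable D.
  apply: (@sub_countable _ _ _ (B `*` C)); last exact: countableX.
  by apply: subset_card_le => p [].
rewrite bigcup_set_type; apply: countable_bigcupT_measurable.
  by rewrite (eq_countable (card_setT D)).
move=> [[N M] /= /[!inE] -[[BN CM] _]].
apply: measurableX; apply: sub_gen_smallest.
  exact: oB.
exact: oC.
Qed.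

End borel_measurability.

Section haar.
Context (R : realType) (G : topologicalGroupType).

(* Left invariance suffices: on a second-countable group it implies right
   invariance ([haar_mulgr]) for a probability measure. *)
Definition is_haar (mu : probability (borel G) R) : Prop :=
  forall (g : G) (A : set (borel G)), measurable A ->
    mu ((fun h : G => (g * h)%g) @^-1` A) = mu A.

Lemma measurable_mulgl (h : G) :
  measurable_fun setT ((fun g : G => (g * h)%g) : borel G -> borel G).
Proof.
apply: continuous_borel_measurable.
apply: (continuous_comp_pair mulg_continuous) => g; [exact: cvg_id|exact: cvg_cst].
Qed.

Context (mu : probability (borel G) R).
Hypotheses (scG : @second_countable G) (haar_mu : is_haar mu).

Lemma haar_invg (A : set (borel G)) : measurable A ->
  mu ((fun g : G => (g^-1)%g) @^-1` A) = mu A.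
Proof.
move=> mA.
pose d (p : G * G) : G := (p.1^-1 * p.2)%g.
have cd : continuous d.
  apply: (continuous_comp_pair mulg_continuous) => p; last exact: cvg_snd.
  by apply: continuous_cvg; [exact: invg_continuous|exact: cvg_fst].
have md := continuous_prod_borel_measurable scG scG cd.
have mE : measurable (d @^-1` A : set (borel G * borel G)).
  by rewrite -[X in measurable X]setTI; exact: md.
have : (mu \x mu)%E (d @^-1` A) = (mu \x^ mu)%E (d @^-1` A).
  apply: product_measure_unique => // B C mB mC.
  exact: product_measure2E.
rewrite /product_measure1 /product_measure2.
have mV : measurable ((fun g : G => (g^-1)%g) @^-1` A : set (borel G)).
  rewrite -[X in measurable X]setTI.
  exact: (continuous_borel_measurable (@invg_continuous G)).
under eq_integral => g _.
  rewrite (_ : (mu \o xsection _) g = mu A); last first.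
    rewrite /= xsectionE; exact: (haar_mu (g^-1)%g mA).
  over.
under [in RHS]eq_integral => g _.
  rewrite (_ : (mu \o ysection _) g = mu ((fun g : G => (g^-1)%g) @^-1` A));
      last first.
    rewrite /= ysectionE -(haar_mu (g^-1)%g mV).
    congr (mu _); apply/seteqP; split=> h /=.
      by rewrite /d /= invgM invgK.
    by rewrite /d /= invgM invgK.
  over.
have cst (c : \bar R) : (\int[mu]_(_ in setT) c = c)%E.
  rewrite integral_cst//; transitivity (c * 1)%E; last by rewrite mule1.
  by congr (c * _)%E; exact: probability_setT.
by move=> eq_int; rewrite -[LHS]cst -eq_int cst.
Qed.

Lemma haar_mulgr (h : G) (A : set (borel G)) : measurable A ->
  mu ((fun g : G => (g * h)%g) @^-1` A) = mu A.
Proof.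
move=> mA.
have mB : measurable ((fun g : G => (g * h)%g) @^-1` A : set (borel G)).
  by rewrite -[X in measurable X]setTI; exact: measurable_mulgl.
have mV : measurable ((fun g : G => (g^-1)%g) @^-1` A : set (borel G)).
  rewrite -[X in measurable X]setTI.
  exact: (continuous_borel_measurable (@invg_continuous G)).
rewrite -(haar_invg mB) -(haar_invg mA) -(haar_mu (h^-1)%g mV).
by congr (mu _); apply/seteqP; split=> g /=; rewrite invgM invgK.
Qed.

End haar.

Section orbits.
Context (R : realType) (G : topologicalGroupType) (Y : ptopologicalType).
Context (a : continuous_action G Y).

Definition orbit_of (y : Y) : set Y := [set a g y | g in [set: G]].

Definition orbits : set (set Y) := [set orbit_of y | y in [set: Y]].

Definition orbit_map (y : Y) : borel G -> borel Y := fun g => a g y.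

Lemma measurable_orbit_map (y : Y) : measurable_fun setT (orbit_map y).
Proof.
apply: continuous_borel_measurable.
apply: (continuous_comp_pair (@act_continuous _ _ a)) => g.
  exact: cvg_id.
exact: cvg_cst.
Qed.

HB.instance Definition _ (y : Y) :=
  isMeasurableFun.Build _ _ _ _ (orbit_map y) (measurable_orbit_map y).

(* [get O] is a point of O as soon as O is nonempty; by [UnifE] the choice of
   this point is immaterial when mu is a Haar measure. *)
Definition Unif (mu : probability (borel G) R) (O : set Y) :
    probability (borel Y) R :=
  distribution mu (orbit_map (get O)).

Lemma UnifE (mu : probability (borel G) R) (O : set Y) (y : Y)
    (A : set (borel Y)) :
  @second_countable G -> is_haar mu -> orbits O -> O y -> measurable A ->
  Unif mu O A = mu [set g | A (a g y)].
Proof.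
move=> scG hmu [z _ <-{O}] Oy mA.
have [g _ gz] : orbit_of z (get (orbit_of z)) by apply: getPex; exists y.
have [h _ hz] := Oy.
have {}gz : get (orbit_of z) = a (g * h^-1)%g y.
  by rewrite -gz -hz -actM -mulgA mulVg mulg1.
rewrite [LHS]/(mu (orbit_map _ @^-1` A)).
transitivity (mu ((fun k : G => (k * (g * h^-1))%g) @^-1` [set k | A (a k y)])).
  by congr (mu _); apply/seteqP; split=> k /=; rewrite /orbit_map gz -actM.
apply: haar_mulgr => //.
rewrite -[X in measurable X]setTI.
exact: (measurable_orbit_map y).
Qed.

(* G^-1 A is the preimage of A under y |-> G y. *)
Definition invariant (P : probability (borel Y) R) : Prop :=
  forall (g : G) (A : set (borel Y)), measurable A -> P (a g @^-1` A) = P A.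

End orbits.

Section processes.
Context (Y : ptopologicalType).
Implicit Types F : nat -> set (set Y).

Definition filtration F : Prop :=
  [/\ forall n, sigma_algebra [set: Y] (F n),
      forall n, F n `<=` (@measurable _ (borel Y)) &
      forall m n, (m <= n)%N -> F m `<=` F n].

Definition stopping_time F (tau : Y -> nat) : Prop :=
  forall n, F n [set y | (tau y <= n)%N].

(* [g_sigma_algebraType F] carries the sigma-algebra generated by F, which is
   F itself when F is a sigma-algebra ([measurable_g_measurableTypeE]). *)
Definition measurable_wrt d (V : measurableType d) (F : set (set Y))
    (X : Y -> V) : Prop :=
  measurable_fun setT (X : g_sigma_algebraType F -> V).

Definition adapted d (V : measurableType d) F (X : nat -> Y -> V) : Prop :=
  forall n, measurable_wrt (F n) (X n).

Context (R : realType).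

(* X is a version of the conditional expectation of Z given F. *)
Definition is_cond_expectation (P : probability (borel Y) R)
    (F : set (set Y)) (Z X : Y -> R) : Prop :=
  [/\ measurable_wrt F X,
      P.-integrable setT (EFin \o X) &
      forall A, F A ->
        (\int[P]_(y in A) (X y)%:E = \int[P]_(y in A) (Z y)%:E)%E].

Definition martingale (P : probability (borel Y) R) F (M : nat -> Y -> R) :
    Prop :=
  [/\ adapted F M,
      forall n, P.-integrable setT (EFin \o M n) &
      forall m n, (m <= n)%N -> is_cond_expectation P (F m) (M n) (M m)].

Definition anytime_valid (G : topologicalGroupType)
    (a : continuous_action G Y) F (eps : nat -> Y -> \bar R) : Prop :=
  forall tau, stopping_time F tau ->
  forall P : probability (borel Y) R, invariant a P ->
    (\int[P]_y eps (tau y) y <= 1)%E.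

End processes.

(* Main.v *)
From HB Require Import structures.
Require Import Defs.
From mathcomp Require Import all_boot all_order all_algebra.
From mathcomp Require Import all_classical all_reals all_analysis.
From mathcomp Require Import measurable_realfun.

Set Implicit Arguments.
Unset Strict Implicit.
Unset Printing Implicit Defensive.

Import Order.TTheory GRing.Theory Num.Theory.
Local Open Scope classical_set_scope.
Local Open Scope ring_scope.

(** Both directions reduce invariance to a single orbit.  The law [Unif O] is
    itself invariant ([Unif_invariant]), and by Tonelli every invariant
    probability is a mixture of such laws ([invariant_disintegration]):
    averaging the equality of the integrals of [f] and [f \o a g] over a
    Haar-distributed [g] turns the integral of [f] under [P] into the
    [P]-average of its integrals over the orbits.  What remains concerns one
    probability [P]: the expectation of [eps] at every stopping time is at
    most [1] iff a nonnegative martingale started at [1] bounds [eps] almost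
    surely.

    If there is such a martingale [M], cut the stopped expectation along the
    events [t = k]; on each of them [M k] may be replaced by a later [M n], so
    every partial sum is at most the integral of [M n], which is that of [M 0]
    ([integral_stopped_le]).

    For the converse, the Snell envelope of [eps] is taken as a family of
    measures rather than of functions, so that neither essential suprema nor
    conditional expectations have to be manipulated.  For [A] in [F n] let
    [snell n A] be the supremum, over the stopping times [t >= n], of the
    integral over [A] of [eps] stopped at [t].  Stopping times can be spliced
    along an event of [F n], so the suprema over disjoint events add up and
    [snell n] is a measure on [F n] ([snell_additive]).  It has mass at most
    [1], vanishes on [P]-null events, is at least the integral of [eps n], and
    decreases with [n].  By Radon-Nikodym relative to [F n], [snell n] has a
    density [S n] and [snell n.+1] a density [T n], which is the conditional
    expectation of [S n.+1].  The martingale is Doob's compensation of the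
    supermartingale [S]:
      [M 0 = 1] and [M n.+1 = S n.+1 + max (M n - T n) 0].
    By induction the integrals of [M n] over the events of [F n] are at least
    [snell n]; hence [T n <= M n] almost surely, the truncation at [0] changes
    nothing up to a null set, and the increments of [M] average to zero on
    [F n].  The truncation makes [M] nonnegative everywhere and not only almost
    surely. *)

(** * Densities and comparisons relative to a sub-sigma-algebra *)

Section subalgebra.
Context (R : realType) (Y : ptopologicalType) (P : probability (borel Y) R).
Context (F : set (set Y)).
Hypotheses (saF : sigma_algebra [set: Y] F)
  (subF : F `<=` (@measurable _ (borel Y))).

Lemma measurable_wrt_preimage d (V : measurableType d) (X : Y -> V)
    (B : set V) :
  measurable_wrt F X -> measurable B -> F (X @^-1` B).
Proof.
move=> mX mB; have := mX measurableT B mB.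
by rewrite setTI (measurable_g_measurableTypeE saF).
Qed.

Lemma measurable_wrt_borel d (V : measurableType d) (X : Y -> V) :
  measurable_wrt F X -> measurable_fun setT (X : borel Y -> V).
Proof.
move=> mX _ B mB; rewrite setTI; apply: subF.
exact: measurable_wrt_preimage mX mB.
Qed.

(** This is Radon-Nikodym on the measurable space whose sigma-algebra is [F],
    carrying the image of [P] under the identity; working there is what makes
    the density [F]-measurable. *)
Lemma trace_density (nu : set Y -> \bar R) :
    nu set0 = 0%E -> (forall A, (0 <= nu A)%E) -> (nu [set: Y] < +oo)%E ->
    semi_sigma_additive (nu : set (g_sigma_algebraType F) -> \bar R) ->
    (forall A, F A -> P A = 0%E -> nu A = 0%E) ->
  exists X : Y -> R, [/\ measurable_wrt F X, forall y, 0 <= X y &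
    forall A, F A -> (\int[P]_(y in A) (X y)%:E = nu A)%E].
Proof.
move=> nu0 nu_ge0 nufin nu_additive nuP.
pose T := g_sigma_algebraType F.
have mF (A : set T) : measurable A -> F A.
  by rewrite (measurable_g_measurableTypeE saF).
pose num : {measure set T -> \bar R} :=
  HB.pack (nu : set T -> \bar R) (isMeasure.Build _ T R nu nu0 nu_ge0 nu_additive).
have nuF_fin : fin_num_fun (nu : set T -> \bar R).
  move=> A mA; rewrite ge0_fin_numE//.
  by rewrite (le_lt_trans _ nufin)//; apply: (le_measure num); rewrite ?inE.
pose nuf : {finite_measure set T -> \bar R} :=
  HB.pack (nu : set T -> \bar R)
    (isMeasure.Build _ T R nu nu0 nu_ge0 nu_additive)
    (Measure_isFinite.Build _ T R num nuF_fin).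
pose i : borel Y -> T := id.
have mi : measurable_fun setT i.
  by move=> _ A mA; rewrite setTI; apply: subF; exact: mF.
pose im : {mfun borel Y >-> T} := HB.pack i (isMeasurableFun.Build _ _ _ _ i mi).
pose Pi := distribution P im.
have [|f [f0 ffin fint fE]] := @radon_nikodym_sigma_finite _ _ _ Pi nuf.
  by apply/null_content_dominatesP => A /mF FA; exact: nuP.
exists (fine \o f); split.
- apply: measurableT_comp => //.
  exact: measurable_int fint.
- by move=> y; rewrite fine_ge0.
move=> A FA.
have mA : measurable (A : set T) by rewrite (measurable_g_measurableTypeE saF).
transitivity (\int[P]_(y in A) f y)%E.
  by apply: eq_integral => y _ /=; rewrite fineK.
rewrite -[RHS]/(nuf A) (fE A mA) ge0_integral_pushforward//.
exact: measurable_funTS (measurable_int _ fint).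
Qed.

(** Comparing [X] and [Z] on the event [Z < X] itself, which belongs to [F]
    because both sides are [F]-measurable, shows that this event is null. *)
Lemma ae_le_from_traces (X : Y -> \bar R) (Z : Y -> R) :
    measurable_wrt F X -> measurable_wrt F Z ->
    (forall y, (0 <= X y)%E) -> (forall y, 0 <= Z y) ->
    P.-integrable setT (EFin \o Z) ->
    (forall A, F A ->
      (\int[P]_(y in A) X y <= \int[P]_(y in A) (Z y)%:E)%E) ->
  {ae P, forall y, (X y <= (Z y)%:E)%E}.
Proof.
move=> FX FZ X0 Z0 iZ XZ.
have mX := measurable_wrt_borel FX.
have mZ := measurable_wrt_borel FZ.
have FEZ : measurable_wrt F (EFin \o Z) by apply/measurable_EFinP.
have FD : measurable_wrt F (fun y => X y - (Z y)%:E)%E.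
  exact: emeasurable_funB.
pose A := [set y | ((Z y)%:E < X y)%E].
have AE : A = (fun y => X y - (Z y)%:E)%E @^-1` [set x | (0 < x)%E].
  by apply/funext => y; rewrite /A /preimage /mkset sube_gt0.
have FA : F A.
  rewrite AE; apply: measurable_wrt_preimage => //.
  by have := emeasurable_itv (`]0%E, +oo[ : interval (\bar R)); rewrite set_itvoy.
have mA : measurable (A : set (borel Y)) by exact: subF.
have mD : measurable_fun setT
  ((fun y => X y - (Z y)%:E)%E : borel Y -> \bar R) by exact: measurable_wrt_borel.
have D0 y : A y -> (0 <= X y - (Z y)%:E)%E.
  by rewrite sube_ge0// => /ltW.
have : (\int[P]_(y in A) (X y - (Z y)%:E) = 0)%E.
  apply/eqP; rewrite eq_le integral_ge0// andbT.
  have := XZ _ FA.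
  (* [X] may be infinite but [Z] is real, so [X = (X - Z) + Z]. *)
  rewrite (_ : \int[P]_(y in A) X y =
     \int[P]_(y in A) (X y - (Z y)%:E) + \int[P]_(y in A) (Z y)%:E)%E; last first.
    rewrite -ge0_integralD//.
    - by apply: eq_integral => y _; rewrite subeK.
    - exact: measurable_funTS.
    - by move=> y _; rewrite lee_fin.
    - by apply/measurable_EFinP; exact: measurable_funTS.
  have Zfin : (\int[P]_(y in A) (Z y)%:E)%E \is a fin_num.
    apply: integrable_fin_num => //; exact: integrableS iZ.
  by rewrite -leeBrDr// subee.
move=> intD0.
have : (\int[P]_(y in A) `|X y - (Z y)%:E| = 0)%E.
  rewrite -[RHS]intD0; apply: eq_integral => y; rewrite inE => Ay.
  by rewrite gee0_abs// D0.
move/(ae_eq_integral_abs P mA (measurable_funTS mD)) => aeD.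
apply: filterS aeD => y /= Dy; rewrite leNgt; apply/negP => Ay.
by have := Ay; rewrite -sube_gt0 ?Dy// ltxx.
Qed.

End subalgebra.

(** * Stopping times *)

Section stopping_times.
Context (R : realType) (Y : ptopologicalType) (F : nat -> set (set Y)).
Hypothesis filtrF : filtration F.
Implicit Types (t : Y -> nat) (A : set Y).

Lemma filtration_sigma_algebra n : sigma_algebra [set: Y] (F n).
Proof. by have [+ _ _] := filtrF. Qed.

Lemma filtration_borel n : F n `<=` (@measurable _ (borel Y)).
Proof. by have [_ + _] := filtrF. Qed.

Lemma filtration_mono m n : (m <= n)%N -> F m `<=` F n.
Proof. by have [_ _ +] := filtrF; apply. Qed.

Lemma filtrationE n A : F n A = @measurable _ (g_sigma_algebraType (F n)) A.
Proof.
by rewrite (measurable_g_measurableTypeE (filtration_sigma_algebra n)).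
Qed.

Lemma measurable_wrt_mono d (V : measurableType d) m n (X : Y -> V) : (m <= n)%N ->
  measurable_wrt (F m) X -> measurable_wrt (F n) X.
Proof.
move=> mn FX _ B mB; rewrite setTI -filtrationE.
apply: (filtration_mono mn).
by apply: measurable_wrt_preimage => //; exact: filtration_sigma_algebra.
Qed.

Lemma stopping_time_cst n : stopping_time F (fun=> n).
Proof.
move=> k; rewrite filtrationE; case: (leqP n k) => nk.
- by rewrite (_ : mkset _ = setT)//; apply/seteqP; split.
- by rewrite (_ : mkset _ = set0)//; apply/seteqP; split.
Qed.

Lemma stopping_time_eq t n : stopping_time F t -> F n [set y | t y = n].
Proof.
move=> st; rewrite filtrationE; case: n => [|n].
  rewrite (_ : mkset _ = [set y | (t y <= 0)%N]); first by rewrite -filtrationE; exact: (st 0%N).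
  by apply/seteqP; split=> y /=; [move=> ->|rewrite leqn0 => /eqP].
rewrite (_ : mkset _ = [set y | (t y <= n.+1)%N] `\` [set y | (t y <= n)%N]).
  apply: measurableD; rewrite -filtrationE; first exact: (st n.+1).
  by apply: filtration_mono (st n).
apply/seteqP; split=> y /=; first by move=> ->; rewrite ltnn.
by move=> [tn1 /negP]; rewrite -ltnNge => tn; apply/eqP; rewrite eqn_leq tn1.
Qed.

Definition splice A t t' (y : Y) : nat := if y \in A then t y else t' y.

(** Since both times wait until [n], the event [A] deciding which of them is
    followed is known when the first of them can stop. *)
Lemma stopping_time_splice n A t t' :
    F n A -> stopping_time F t -> stopping_time F t' ->
    (forall y, n <= t y)%N -> (forall y, n <= t' y)%N ->
  stopping_time F (splice A t t').
Proof.
move=> FA st st' nt nt' k; case: (leqP n k) => nk; last first.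
  rewrite filtrationE (_ : mkset _ = set0)//; apply/seteqP; split=> // y /=.
  apply/negP; rewrite -ltnNge; apply: (leq_trans nk).
  by rewrite /splice; case: ifP.
have FkA : F k A by exact: filtration_mono FA.
rewrite (_ : mkset _ = (A `&` [set y | (t y <= k)%N]) `|`
  (~` A `&` [set y | (t' y <= k)%N])).
  have mA : measurable (A : set (g_sigma_algebraType (F k))).
    by rewrite -filtrationE.
  rewrite filtrationE; apply: measurableU; apply: measurableI => //.
  - by rewrite -filtrationE; exact: (st k).
  - exact: measurableC.
  - by rewrite -filtrationE; exact: (st' k).
apply/seteqP; split=> y /=; rewrite /splice; case: ifPn => [/set_mem|/negP] yA.
- by left.
- by right; split=> // /mem_set.
- by case=> -[].
- by case=> -[// /mem_set].
Qed.

Lemma measurable_stopped (eps : nat -> Y -> \bar R) t :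
  adapted F eps -> stopping_time F t ->
  measurable_fun setT ((fun y => eps (t y) y) : borel Y -> \bar R).
Proof.
move=> Feps st _ B mB; rewrite setTI.
rewrite (_ : _ @^-1` B = \bigcup_k ([set y | t y = k] `&` eps k @^-1` B)).
  apply: bigcupT_measurable => k; apply: measurableI.
    by apply: (@filtration_borel k); exact: stopping_time_eq.
  apply: (@filtration_borel k).
  exact: (measurable_wrt_preimage (filtration_sigma_algebra k) (Feps k)).
apply/seteqP; split=> y /=; first by exists (t y).
by move=> [k _ [/= <-]].
Qed.

End stopping_times.

(** * The Snell envelope as a family of measures *)

Section snell_envelope.
Context (R : realType) (Y : ptopologicalType) (P : probability (borel Y) R).
Context (F : nat -> set (set Y)) (eps : nat -> Y -> \bar R).
Hypotheses (filtrF : filtration F) (eps_ge0 : forall n y, (0 <= eps n y)%E)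
  (Feps : adapted F eps).
Hypothesis valid : forall t, stopping_time F t ->
  (\int[P]_y eps (t y) y <= 1)%E.
Implicit Types (t : Y -> nat) (A B : set Y).

Definition stopping_after n : set (Y -> nat) :=
  [set t | stopping_time F t /\ forall y, (n <= t y)%N].

(** On events of [F n] this is the integral of the Snell envelope of [eps] at
    time [n], the essential supremum over [t] of the conditional expectations
    given [F n] of [eps] stopped at [t]. *)
Definition snell n A : \bar R :=
  ereal_sup [set (\int[P]_(y in A) eps (t y) y)%E | t in stopping_after n].

Let meps t : stopping_time F t ->
  measurable_fun setT ((fun y => eps (t y) y) : borel Y -> \bar R).
Proof. exact: measurable_stopped. Qed.

Let measurableF n A : F n A -> measurable (A : set (borel Y)).
Proof. exact: filtration_borel. Qed.

Lemma stopping_after_cst n : stopping_after n (fun=> n).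
Proof. by split => //; exact: stopping_time_cst. Qed.

Lemma integral_le_snell n t A : stopping_after n t ->
  (\int[P]_(y in A) eps (t y) y <= snell n A)%E.
Proof. by move=> nt; apply: ereal_sup_ubound; exists t. Qed.

Lemma snell_ge0 n A : (0 <= snell n A)%E.
Proof.
apply: le_trans (integral_le_snell A (stopping_after_cst n)).
exact: integral_ge0.
Qed.

Lemma snell0 n : snell n set0 = 0%E.
Proof.
apply/eqP; rewrite eq_le snell_ge0 andbT; apply: ge_ereal_sup => _ [t _ <-].
by rewrite integral_set0.
Qed.

Lemma snellT n : (snell n setT <= 1)%E.
Proof. by apply: ge_ereal_sup => _ [t [st _] <-]; exact: valid. Qed.

Lemma le_snell n A B : measurable (A : set (borel Y)) ->
  measurable (B : set (borel Y)) -> A `<=` B -> (snell n A <= snell n B)%E.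
Proof.
move=> mA mB AB; apply: ge_ereal_sup => _ [t nt <-].
apply: le_trans (integral_le_snell B nt); apply: ge0_subset_integral => //.
by apply: measurable_funTS; apply: meps; case: nt.
Qed.

Lemma snell_decreasing n A : (snell n.+1 A <= snell n A)%E.
Proof.
apply: ereal_sup_le => _ [t [st nt] <-]; exists t => //.
by split=> // y; rewrite ltnW.
Qed.

Lemma snell_null n A : F n A -> P A = 0%E -> snell n A = 0%E.
Proof.
move=> /measurableF mA PA; apply/eqP; rewrite eq_le snell_ge0 andbT.
apply: ge_ereal_sup => _ [t [st _] <-].
by rewrite null_set_integral//; apply: measurable_funTS; exact: meps.
Qed.

Lemma snell_fin_num n A : F n A -> snell n A \is a fin_num.
Proof.
move=> /measurableF mA; rewrite ge0_fin_numE ?snell_ge0//.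
apply: le_lt_trans (ltry 1); apply: le_trans (snellT n).
exact: le_snell.
Qed.

(** Two stopping times, one nearly optimal on [A] and the other on [B], are
    spliced into one that is nearly optimal on both events. *)
Lemma snellU_ge n A B : F n A -> F n B -> A `&` B = set0 ->
  (snell n A + snell n B <= snell n (A `|` B))%E.
Proof.
move=> FA FB AB0.
rewrite -leeBrDr ?snell_fin_num//; apply: ge_ereal_sup => _ [t [st nt] <-].
rewrite leeBrDr ?snell_fin_num// addeC.
have tfin : (\int[P]_(y in A) eps (t y) y)%E \is a fin_num.
  rewrite ge0_fin_numE ?integral_ge0//.
  apply: le_lt_trans (integral_le_snell A (conj st nt)) _.
  by rewrite -ge0_fin_numE ?snell_ge0// snell_fin_num.
rewrite -leeBrDr//; apply: ge_ereal_sup => _ [t' [st' nt'] <-].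
rewrite leeBrDr// addeC.
have su : stopping_after n (splice A t t').
  split; first exact: stopping_time_splice FA st st' nt nt'.
  by move=> y; rewrite /splice; case: ifP.
apply: le_trans (integral_le_snell (A `|` B) su).
rewrite ge0_integral_setU//; first last.
- exact/disj_set2P.
- by apply: measurable_funTS; apply: meps; case: su.
- exact: measurableF FB.
- exact: measurableF FA.
apply: leeD; rewrite le_eqVlt; apply/orP; left; apply/eqP;
  apply: eq_integral => y yAB; rewrite /splice.
- by rewrite yAB.
- rewrite ifF//; apply/negbTE/negP => yA.
  by have : (A `&` B) y; [split; exact: set_mem|rewrite AB0].
Qed.

(** The sum bounds the union because integrating along a single stopping time is
    additive; the converse is [snellU_ge] on finite unions.  The older
    sigma-algebra [F m] is allowed because the density of [snell n.+1] relative
    to [F n] plays the role of a conditional expectation. *)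
Lemma snell_additive m n : (m <= n)%N ->
  semi_sigma_additive (snell n : set (g_sigma_algebraType (F m)) -> \bar R).
Proof.
move=> mn A mA tA mUA.
have FmA i : F n (A i).
  by apply: (filtration_mono filtrF mn); rewrite filtrationE.
have FUA k : F n (\big[setU/set0]_(i < k) A i).
  by rewrite filtrationE//; apply: bigsetU_measurable => i _;
    rewrite -filtrationE.
have mUA' : measurable (\bigcup_i A i : set (borel Y)).
  by apply: bigcupT_measurable => i; exact: measurableF (FmA i).
have cA : cvgn (fun k => \sum_(0 <= i < k) snell n (A i))%E.
  by apply: is_cvg_ereal_nneg_natsum => i _; exact: snell_ge0.
have -> : snell n (\bigcup_i A i) = (\sum_(0 <= i <oo) snell n (A i))%E.
  apply/eqP; rewrite eq_le; apply/andP; split.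
    apply: ge_ereal_sup => _ [t nt <-].
    rewrite ge0_integral_bigcup//; first last.
    - by apply: measurable_funTS; apply: meps; case: nt.
    - by move=> i; exact: measurableF (FmA i).
    apply: lee_nneseries => [i _ _|i _]; first exact: integral_ge0.
    exact: integral_le_snell.
  apply: lime_le => //; apply: nearW => k.
  apply: (@le_trans _ _ (snell n (\big[setU/set0]_(i < k) A i))).
    elim: k => [|k IH]; first by rewrite big_geq// snell_ge0.
    rewrite big_nat_recr//= big_ord_recr/=.
    apply: le_trans (leeD2r _ IH) _; apply: snellU_ge => //.
    by apply: (@trivIset_bigsetUI _ predT) => //; exact: sub_trivIset tA.
  apply: le_snell => //; first exact: measurableF (FUA k).
  exact: bigsetU_bigcup.
exact: cA.
Qed.

Lemma snell_density m n : (m <= n)%N ->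
  exists X : Y -> R, [/\ measurable_wrt (F m) X, forall y, 0 <= X y &
    forall A, F m A -> (\int[P]_(y in A) (X y)%:E = snell n A)%E].
Proof.
move=> mn; apply: trace_density.
- exact: filtration_sigma_algebra.
- exact: filtration_borel.
- exact: snell0.
- exact: snell_ge0.
- exact: le_lt_trans (snellT n) (ltry 1).
- exact: snell_additive.
- by move=> A FA; apply: snell_null; exact: filtration_mono FA.
Qed.

End snell_envelope.

(** * The martingale that dominates the Snell envelope *)

(** Doob's compensation of the supermartingale [S], where [T n] stands for the
    conditional expectation of [S n.+1] at time [n]: the part of the current
    value exceeding [T n] is saved, and [T n] is exchanged for [S n.+1]. *)
Fixpoint compensated_sum (R : realType) (Y : Type) (S T : nat -> Y -> R)
    (n : nat) : Y -> R :=
  if n is n'.+1 then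
    fun y => S n y + Num.max (compensated_sum S T n' y - T n' y) 0
  else fun=> 1.

Section dominating_martingale.
Context (R : realType) (Y : ptopologicalType) (P : probability (borel Y) R).
Context (F : nat -> set (set Y)) (eps : nat -> Y -> \bar R).
Hypotheses (filtrF : filtration F) (F0 : F 0%N = [set set0; [set: Y]])
  (eps_ge0 : forall n y, (0 <= eps n y)%E) (Feps : adapted F eps).

Lemma martingale_from_steps (M : nat -> Y -> R) :
    adapted F M -> (forall n, P.-integrable setT (EFin \o M n)) ->
    (forall n A, F n A ->
      (\int[P]_(y in A) (M n.+1 y)%:E = \int[P]_(y in A) (M n y)%:E)%E) ->
  martingale P F M.
Proof.
move=> FM iM stepM; split=> // m n mn; split=> // A FA.
elim: n mn => [|n IH]; first by rewrite leqn0 => /eqP ->.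
rewrite leq_eqVlt => /predU1P[<- //|]; rewrite ltnS => mn.
by rewrite (IH mn) stepM//; exact: filtration_mono FA.
Qed.

Hypothesis valid : forall t, stopping_time F t ->
  (\int[P]_y eps (t y) y <= 1)%E.
Variables S T : nat -> Y -> R.
Hypotheses (FS : adapted F S) (FT : adapted F T)
  (S_ge0 : forall n y, 0 <= S n y) (T_ge0 : forall n y, 0 <= T n y)
  (SE : forall n A, F n A ->
    (\int[P]_(y in A) (S n y)%:E = snell P F eps n A)%E)
  (TE : forall n A, F n A ->
    (\int[P]_(y in A) (T n y)%:E = snell P F eps n.+1 A)%E).

Let M := compensated_sum S T.

Let measurableF n A : F n A -> measurable (A : set (borel Y)).
Proof. exact: filtration_borel. Qed.

Let borelF n (X : Y -> R) : measurable_wrt (F n) X ->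
  measurable_fun setT (X : borel Y -> R).
Proof.
by apply: measurable_wrt_borel;
  [exact: filtration_sigma_algebra|exact: filtration_borel].
Qed.

Lemma compensated_sum_ge0 n y : 0 <= M n y.
Proof.
case: n => [|n]; first exact: ler01.
by rewrite /M/= addr_ge0// le_max lexx orbT.
Qed.

Lemma compensated_sum_adapted : adapted F M.
Proof.
elim=> [|n IH]; first exact: measurable_cst.
apply: (@measurable_funD _ (g_sigma_algebraType (F n.+1))); first exact: FS.
apply: (measurable_wrt_mono filtrF (leqnSn n)).
apply: (@measurable_maxr _ (g_sigma_algebraType (F n))); last first.
  exact: measurable_cst.
by apply: (@measurable_funB _ (g_sigma_algebraType (F n))); [exact: IH|exact: FT].
Qed.

Let above n := P.-integrable setT (EFin \o M n) /\
  forall A, F n A -> (snell P F eps n A <= \int[P]_(y in A) (M n y)%:E)%E.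

(** Being above the Snell envelope makes [T n <= M n] almost surely, since
    [T n] is the density of [snell n.+1], which is below [snell n]; so the
    truncation at [0] is invisible to integrals. *)
Lemma excess_balance n A : above n -> F n A ->
  (\int[P]_(y in A) (T n y)%:E +
   \int[P]_(y in A) (Num.max (M n y - T n y) 0)%:E =
   \int[P]_(y in A) (M n y)%:E)%E.
Proof.
move=> [iM snM] FA.
have mA := measurableF FA.
have mM := borelF (@compensated_sum_adapted n).
have mT := borelF (@FT n).
have mMT : measurable_fun setT
    ((fun y => Num.max (M n y - T n y) 0) : borel Y -> R).
  by apply: measurable_maxr; [exact: measurable_funB|exact: measurable_cst].
have TM : {ae P, forall y, ((T n y)%:E <= (M n y)%:E)%E}.
  apply: (@ae_le_from_traces _ _ _ (F n)) => //.
  - exact: filtration_sigma_algebra.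
  - exact: filtration_borel.
  - by apply/measurable_EFinP; exact: FT.
  - exact: compensated_sum_adapted.
  - by move=> y; rewrite lee_fin.
  - exact: compensated_sum_ge0.
  - move=> B FB; rewrite TE//; apply: le_trans (snM _ FB).
    exact: snell_decreasing.
rewrite -ge0_integralD//; last 4 first.
- by move=> y _; rewrite lee_fin.
- by apply/measurable_EFinP; exact: measurable_funTS.
- by move=> y _; rewrite lee_fin le_max lexx orbT.
- by apply/measurable_EFinP; exact: measurable_funTS.
apply: ge0_ae_eq_integral => //.
- apply: emeasurable_funD; apply/measurable_EFinP; exact: measurable_funTS.
- by apply/measurable_EFinP; exact: measurable_funTS.
- by move=> y _; rewrite lee_fin addr_ge0// le_max lexx orbT.
- by move=> y _; rewrite lee_fin; exact: compensated_sum_ge0.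
apply: (@filterS _ _ (ae_filter_ringOfSetsType P) _ _ _ TM) => y /=; rewrite lee_fin => TMy _.
by rewrite -EFinD (max_idPl _) ?subr_ge0// addrC subrK.
Qed.

Lemma compensated_sumS_integral n A : F n.+1 A ->
  (\int[P]_(y in A) (M n.+1 y)%:E = snell P F eps n.+1 A +
   \int[P]_(y in A) (Num.max (M n y - T n y) 0)%:E)%E.
Proof.
move=> FA; rewrite -SE//.
have mMT : measurable_fun setT
    ((fun y => Num.max (M n y - T n y) 0) : borel Y -> R).
  apply: measurable_maxr; last exact: measurable_cst.
  apply: measurable_funB; apply: borelF; last exact: FT.
  exact: compensated_sum_adapted.
rewrite -ge0_integralD//.
- exact: measurableF FA.
- by move=> y _; rewrite lee_fin.
- by apply/measurable_EFinP; apply: measurable_funTS; exact: borelF (@FS _).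
- by move=> y _; rewrite lee_fin le_max lexx orbT.
- by apply/measurable_EFinP; exact: measurable_funTS.
Qed.

Lemma compensated_sum_step n A : above n -> F n A ->
  (\int[P]_(y in A) (M n.+1 y)%:E = \int[P]_(y in A) (M n y)%:E)%E.
Proof.
move=> aM FA; rewrite compensated_sumS_integral; last first.
  exact: filtration_mono FA.
by rewrite -TE// excess_balance.
Qed.

(** At time [0] only the two events of the trivial sigma-algebra have to be
    compared, and [snell 0] has mass at most [1].  Afterwards [M n.+1] is above
    because it is [S n.+1] plus a nonnegative term. *)
Lemma compensated_sum_above n : above n.
Proof.
elim: n => [|n IH].
  split=> [|A]; first exact: finite_measure_integrable_cst.
  rewrite F0 => -[->|->]; first by rewrite snell0// integral_set0.
  rewrite [leRHS](_ : _ = 1%E); first exact: snellT.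
  rewrite -[LHS]/(\int[P]_(y in setT) cst 1%E y)%E integral_cst// mul1e.
  exact: probability_setT.
have FT0 : F n setT by rewrite filtrationE.
split=> [|A FA].
  apply/integrableP; split.
    by apply/measurable_EFinP; exact: borelF (@compensated_sum_adapted _).
  under eq_integral do rewrite gee0_abs ?lee_fin ?compensated_sum_ge0//.
  rewrite compensated_sum_step//; case: IH => /integrableP[_ + _].
  by under eq_integral do rewrite gee0_abs ?lee_fin ?compensated_sum_ge0//.
rewrite compensated_sumS_integral// leeDl// integral_ge0// => y _.
by rewrite lee_fin le_max lexx orbT.
Qed.

Lemma compensated_sum_martingale : martingale P F M.
Proof.
apply: martingale_from_steps; first exact: compensated_sum_adapted.
- by move=> n; case: (compensated_sum_above n).
- by move=> n A; apply: compensated_sum_step; exact: compensated_sum_above.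
Qed.

Lemma le_compensated_sum : \forall y \ae P, forall n, (eps n y <= (M n y)%:E)%E.
Proof.
apply: ae_foralln => n; have [iM snM] := compensated_sum_above n.
apply: (@ae_le_from_traces _ _ _ (F n)) => //.
- exact: filtration_sigma_algebra.
- exact: filtration_borel.
- exact: compensated_sum_adapted.
- exact: compensated_sum_ge0.
- move=> A FA; apply: le_trans (snM _ FA).
  exact: integral_le_snell (stopping_after_cst _ _).
Qed.

End dominating_martingale.

(** [S n] and [T n] are the densities of the traces of [snell n] and [snell n.+1]
    on [F n]. *)
Lemma dominating_martingale_exists (R : realType) (Y : ptopologicalType)
    (P : probability (borel Y) R) (F : nat -> set (set Y))
    (eps : nat -> Y -> \bar R) :
    filtration F -> F 0%N = [set set0; [set: Y]] ->
    (forall n y, (0 <= eps n y)%E) -> adapted F eps ->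
    (forall t, stopping_time F t -> (\int[P]_y eps (t y) y <= 1)%E) ->
  exists M : nat -> Y -> R,
    [/\ martingale P F M, forall n y, 0 <= M n y, forall y, M 0%N y = 1 &
      \forall y \ae P, forall n, (eps n y <= (M n y)%:E)%E].
Proof.
move=> filtrF F0 eps_ge0 Feps valid.
have density := snell_density filtrF eps_ge0 Feps valid.
have [S /all_and3[FS S_ge0 SE]] := choice (fun n => density n n (leqnn n)).
have [T /all_and3[FT T_ge0 TE]] := choice (fun n => density n n.+1 (leqnSn n)).
exists (compensated_sum S T); split => //.
- exact: compensated_sum_martingale SE TE.
- exact: compensated_sum_ge0.
- exact: le_compensated_sum SE TE.
Qed.

(** * Optional stopping *)

Section optional_stopping.
Context (R : realType) (Y : ptopologicalType) (P : probability (borel Y) R).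
Context (F : nat -> set (set Y)) (M : nat -> Y -> R).
Hypotheses (filtrF : filtration F) (martM : martingale P F M)
  (M_ge0 : forall n y, 0 <= M n y).

(** No bound on [t] is required: the first [n] terms of the sum over the values
    of [t] are controlled by [M n] on the event [t < n], hence by the integral
    of [M n], which is constant in [n]. *)
Lemma integral_stopped_le (eps : nat -> Y -> \bar R) (t : Y -> nat) :
    (forall n y, (0 <= eps n y)%E) -> adapted F eps -> stopping_time F t ->
    (\forall y \ae P, forall n, (eps n y <= (M n y)%:E)%E) ->
  (\int[P]_y eps (t y) y <= \int[P]_y (M 0%N y)%:E)%E.
Proof.
move=> eps_ge0 Feps st epsM.
have [FM iM condM] := martM.
pose D k := [set y | t y = k].
have FD k : F k (D k) by exact: stopping_time_eq.
have mD k : measurable (D k : set (borel Y)).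
  by apply: (filtration_borel filtrF); exact: FD.
have tD (B : set nat) : trivIset B D.
  by move=> i j _ _ [y [/= <- <-]].
have UD : \bigcup_k D k = setT.
  by apply/seteqP; split=> // y _; exists (t y).
have meps := measurable_stopped filtrF Feps st.
have mM n : measurable_fun setT (EFin \o M n : borel Y -> \bar R).
  exact: measurable_int (iM n).
rewrite -[X in (\int[P]_(y in X) eps (t y) y)%E]UD ge0_integral_bigcup//;
  last by exact: measurable_funTS.
apply: lime_le.
  by apply: is_cvg_ereal_nneg_natsum => k _; exact: integral_ge0.
apply: nearW => n.
apply: (@le_trans _ _ (\sum_(0 <= k < n) \int[P]_(y in D k) (M n y)%:E)%E).
  rewrite big_nat_cond [leRHS]big_nat_cond.
  apply: lee_sum => k /andP[/andP[_ kn] _].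
  have [_ _ <-//] := condM k n (ltnW kn).
  rewrite (eq_integral (eps k : borel Y -> \bar R)); last first.
    by move=> y; rewrite inE => <-.
  apply: ae_ge0_le_integral => //.
  - apply: measurable_funTS; apply: measurable_wrt_borel (Feps k).
      exact: filtration_sigma_algebra.
    exact: filtration_borel.
  - by move=> y _; rewrite lee_fin.
  - by apply: measurable_funTS; exact: mM.
  - by apply: (@filterS _ _ (ae_filter_ringOfSetsType P) _ _ _ epsM).
rewrite -ge0_integral_bigsetU//; first last.
- by move=> y _; rewrite lee_fin.
- by apply: measurable_funTS; exact: mM.
- exact: iota_uniq.
have [_ _ /(_ setT)->//] := condM 0%N n (leq0n n).
  apply: ge0_subset_integral => //.
  - exact: bigsetU_measurable.
  - exact: mM.
  - by move=> y _; rewrite lee_fin.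
by rewrite (filtrationE filtrF).
Qed.

End optional_stopping.

(** * Invariant laws as mixtures of orbit laws *)

Section invariant_averaging.
Context (R : realType) (G : topologicalGroupType) (Y : ptopologicalType).
Context (a : continuous_action G Y) (haar : probability (borel G) R).
Hypothesis haarP : is_haar haar.

(** Moving a Haar-distributed point of the orbit by [g] amounts to a left
    translation of the group element that produces it. *)
Lemma Unif_invariant (O : set Y) : Defs.invariant a (Unif a haar O).
Proof.
move=> g A mA; set y := get O.
have mO : measurable (orbit_map a y @^-1` A : set (borel G)).
  by rewrite -[X in measurable X]setTI; exact: (measurable_orbit_map a y).
rewrite [LHS]/(haar (orbit_map a y @^-1` (a g @^-1` A))).
rewrite -[RHS](haarP g mO); congr (haar _).
by apply/funext => h; rewrite /preimage /mkset /orbit_map actM.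
Qed.

Lemma measurable_act (g : G) :
  measurable_fun setT (a g : borel Y -> borel Y).
Proof.
apply: continuous_borel_measurable.
apply: (continuous_comp_pair (@act_continuous _ _ a)) => y.
  exact: cvg_cst.
exact: cvg_id.
Qed.

Hypotheses (scG : @second_countable G) (scY : @second_countable Y).
Variable P : probability (borel Y) R.
Hypothesis invP : Defs.invariant a P.

Lemma invariant_integral (g : G) (f : borel Y -> \bar R) :
  measurable_fun setT f -> (forall y, (0 <= f y)%E) ->
  (\int[P]_y f (a g y) = \int[P]_y f y)%E.
Proof.
move=> mf f0.
have <- := ge0_integral_pushforward (measurable_act g) P measurableT mf
  (fun y _ => f0 y).
apply: eq_measure_integral => [|mg A mA _]; first exact: measurable_act.
exact: invP.
Qed.

Lemma integral_Unif (y : Y) (f : borel Y -> \bar R) :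
  measurable_fun setT f -> (forall y, (0 <= f y)%E) ->
  (\int[Unif a haar (orbit_of a y)]_x f x = \int[haar]_g f (a g y))%E.
Proof.
move=> mf f0.
rewrite -(ge0_integral_pushforward (measurable_orbit_map a y) haar measurableT mf)//.
apply: eq_measure_integral => A mA _.
apply: UnifE => //; first by exists y.
by exists 1%g => //; rewrite act1.
Qed.

Lemma measurable_action_pair (f : borel Y -> \bar R) :
  measurable_fun setT f ->
  measurable_fun setT
    ((fun p => f (a p.1 p.2)) : borel G * borel Y -> \bar R).
Proof.
move=> mf; apply: measurableT_comp mf _.
exact: (continuous_prod_borel_measurable scG scY (@act_continuous _ _ a)).
Qed.

Lemma measurable_integral_Unif (f : borel Y -> \bar R) :
  measurable_fun setT f -> (forall y, (0 <= f y)%E) ->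
  measurable_fun setT
    ((fun y => \int[Unif a haar (orbit_of a y)]_x f x)%E : borel Y -> \bar R).
Proof.
move=> mf f0.
apply: eq_measurable_fun (measurable_fun_fubini_tonelli_G (m1 := haar) _
  (measurable_action_pair mf) _) => //.
by move=> y _; rewrite integral_Unif.
Qed.

(** By invariance the integral of [f (a g y)] in [y] is the same for all [g], so
    it equals its Haar average over [g]; exchanging the two integrals leaves the
    orbit average of [f] inside. *)
Lemma invariant_disintegration (f : borel Y -> \bar R) :
  measurable_fun setT f -> (forall y, (0 <= f y)%E) ->
  (\int[P]_y f y =
   \int[P]_y \int[Unif a haar (orbit_of a y)]_x f x)%E.
Proof.
move=> mf f0.
under [RHS]eq_integral do rewrite integral_Unif//.
rewrite -(fubini_tonelli _ (measurable_action_pair mf))//=.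
under [RHS]eq_integral do rewrite (invariant_integral _ mf f0).
rewrite -[RHS]/(\int[haar]_(g in setT) cst (\int[P]_y f y) g)%E.
rewrite integral_cst// [X in (_ * X)%E](_ : _ = 1%E) ?mule1//.
exact: probability_setT.
Qed.

End invariant_averaging.

Theorem theorem8 (R : realType)
    (G : topologicalGroupType) (Y : ptopologicalType)
    (compactG : compact [set: G]) (hausdorffG : hausdorff_space G)
    (secondG : @second_countable G)
    (loccompactY : locally_compact [set: Y]) (hausdorffY : hausdorff_space Y)
    (secondY : @second_countable Y)
    (a : continuous_action G Y)
    (haar : probability (borel G) R) (haarP : is_haar haar)
    (I_ : nat -> set (set Y)) (filtrI : filtration I_)
    (I0 : I_ 0%N = [set set0; [set: Y]])
    (eps : nat -> Y -> \bar R) (eps_ge0 : forall n y, (0 <= eps n y)%E)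
    (eps_adapted : adapted I_ eps) :
  anytime_valid a I_ eps <->
  (forall O : set Y, orbits a O ->
    exists M : nat -> Y -> R,
      [/\ martingale (Unif a haar O) I_ M,
          forall n y, 0 <= M n y,
          forall y, M 0%N y = 1 &
          \forall y \ae Unif a haar O, forall n, (eps n y <= (M n y)%:E)%E]).
Proof.
split=> [valid O _|dominated t st P invP].
  apply: dominating_martingale_exists => // t st.
  by apply: valid => //; exact: Unif_invariant.
have meps := measurable_stopped filtrI eps_adapted st.
rewrite (invariant_disintegration haarP secondG secondY invP)//.
apply: (@le_trans _ _ (\int[P]_(y in setT) cst 1 y)%E); last first.
  rewrite integral_cst// mul1e; exact: probability_le1.
apply: ge0_le_integral => //.
- by move=> y _; exact: integral_ge0.
- exact: measurable_integral_Unif.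
move=> y _; have [|M [martM M_ge0 M0 epsM]] := dominated (orbit_of a y).
  by exists y.
apply: le_trans (integral_stopped_le filtrI martM M_ge0 eps_ge0 eps_adapted
  st epsM) _.
under eq_integral do rewrite M0.
rewrite -[leLHS]/(\int[Unif a haar (orbit_of a y)]_(x in setT) cst 1 x)%E.
rewrite integral_cst// mul1e; exact: probability_le1.
Qed.
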